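(* Let $\mathcal M=(\mathcal C,\mathsf T)$ be a CBPV model that is adequate with respect to a program relation $\preccurlyeq$. If every morphism of the form $f:X\to TY$ in $\mathcal C$ is lax discardable, lax copyable, and lax central, then for every closed source-language expression $e:\mathbf{bool}$ we have $$\mathcal V(e)\preccurlyeq\mathcal N(e).$$
   Context: **Order-enriched notions.** A Poset-category is a category $\mathcal C$ with a partial order $\sqsubseteq$ on each hom-set such that composition is monotone. It is cartesian if it has a terminal object $1$ (unique maps $\langle\rangle_X:X\to 1$) and binary products (projections $\pi_i$) with monotone pairing $\langle-,-\rangle$; $\mathrm{assoc}:(X_1\times X_2)\times X_3\to X_1\times(X_2\times X_3)$ is the canonical isomorphism. It is cartesian closed if moreover it has exponentials $X\Rightarrow Y$ with monotone currying $\Lambda:\mathcal C(W\times X,Y)\to\mathcal C(W,X\Rightarrow Y)$. Binary coproducts are required to have monotone copairing $[-,-]$. A strong Poset-monad $\mathsf T$ on a cartesian $\mathcal C$ consists of objects $TX$, morphisms $\eta_X:X\to TX$, and monotone functions $(-)^{\dagger(W\times\square)}:\mathcal C(W\times X,TY)\to\mathcal C(W\times TX,TY)$ such that: $f^{\dagger(W\times\square)}\circ(w\times \mathrm{id})=(f\circ(w\times\mathrm{id}))^{\dagger(W'\times\square)}$ for $w:W'\to W$; $f^{\dagger(W\times\square)}\circ(\mathrm{id}_W\times\eta_X)=f$; $(\eta_X\circ\pi_2)^{\dagger(1\times\square)}=\pi_2$; and $(g^{\dagger(W'\times\square)}\circ(\mathrm{id}_{W'}\times f)\circ\mathrm{assoc})^{\dagger((W'\times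 W)\times\square)}=g^{\dagger(W'\times\square)}\circ(\mathrm{id}_{W'}\times f^{\dagger(W\times\square)})\circ\mathrm{assoc}$ for $f:W\times X\to TY$, $g:W'\times Y\to TZ$. A $\mathsf T$-algebra $\mathsf Z$ is an object $Z=U_{\mathsf T}\mathsf Z$ (the carrier) with monotone functions $(-)^{\ddagger(W\times\square)}:\mathcal C(W\times X,Z)\to\mathcal C(W\times TX,Z)$ satisfying the same naturality in $W$, the left unit law $f^{\ddagger(W\times\square)}\circ(\mathrm{id}_W\times\eta_X)=f$, and associativity $(g^{\ddagger(W'\times\square)}\circ(\mathrm{id}_{W'}\times f)\circ\mathrm{assoc})^{\ddagger((W'\times W)\times\square)}=g^{\ddagger(W'\times\square)}\circ(\mathrm{id}_{W'}\times f^{\dagger(W\times\square)})\circ\mathrm{assoc}$ for $f:W\times X\to TY$, $g:W'\times Y\to Z$. Derived notation: for $f:X\to TY$, $f^\dagger:TX\to TY$ is the case $W=1$ (using $1\times X\cong X$); $Tf=(\eta_Y\circ f)^\dagger$ for $f:X\to Y$; $f^{\dagger(\square\times W)}=(f\circ\langle\pi_2,\pi_1\rangle)^{\dagger(W\times\square)}\circ\langle\pi_2,\pi_1\rangle:TX\times W\to TY$ for $f:X\times W\to TY$; $\mathrm{seq}^{L}_{X_1,X_2}=(\eta_{X_1\times X_2}^{\dagger(X_1\times\square)})^{\dagger(\square\times TX_2)}$ and $\mathrm{seq}^{R}_{X_1,X_2}=(\eta_{X_1\times X_2}^{\dagger(\square\times X_2)})^{\dagger(TX_1\times\square)}$, both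 $TX_1\times TX_2\to T(X_1\times X_2)$. A morphism $f:X\to TY$ is lax discardable if $T\langle\rangle_Y\circ f\sqsubseteq\eta_1\circ\langle\rangle_X$; lax copyable if $T\langle\mathrm{id}_Y,\mathrm{id}_Y\rangle\circ f\sqsubseteq\mathrm{seq}^L_{Y,Y}\circ\langle f,f\rangle$; lax central if $\mathrm{seq}^L_{Y,W}\circ(f\times\mathrm{id}_{TW})\sqsubseteq\mathrm{seq}^R_{Y,W}\circ(f\times\mathrm{id}_{TW})$ for all objects $W$. Algebra constructions: the free algebra $F_{\mathsf T}X$ has carrier $TX$ and extension $(-)^{\dagger(W\times\square)}$; the product $\mathsf Z_1\times\mathsf Z_2$ has carrier $Z_1\times Z_2$ and $f^{\ddagger(W\times\square)}=\langle(\pi_1\circ f)^{\ddagger(W\times\square)},(\pi_2\circ f)^{\ddagger(W\times\square)}\rangle$; the power $Y\Rightarrow\mathsf Z$ has carrier $Y\Rightarrow Z$ and $f^{\ddagger(W\times\square)}=\Lambda\big((\Lambda^{-1}f\circ\beta_{W,Y,X})^{\ddagger((W\times Y)\times\square)}\circ\beta_{W,TX,Y}\big)$, where $\beta_{X_1,X_2,X_3}:(X_1\times X_2)\times X_3\to(X_1\times X_3)\times X_2$ is the canonical isomorphism. A CBPV model $\mathcal M=(\mathcal C,\mathsf T)$ is a cartesian closed Poset-category $\mathcal C$ admitting the coproduct $2=1+1$ (coprojections $\mathrm{inl},\mathrm{inr}$), with a strong Poset-monad $\mathsf T$ on $\mathcal C$. Then $W+W$ exists for all $W$, and $\mathrm{dist}_W:W\times2\to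 W+W$ denotes the inverse of the canonical map. **Call-by-push-value (CBPV).** Value types $A::=\mathbf{unit}\mid A_1\times A_2\mid\mathbf{bool}\mid\mathbf U\,\underline C$; computation types $\underline C::=\underline C_1\underline\times\,\underline C_2\mid A\to\underline C\mid\mathbf F A$. Values $V::=x\mid()\mid(V_1,V_2)\mid\mathbf{true}\mid\mathbf{false}\mid\mathbf{thunk}\,M$. Computations $M::=\lambda\{1.M_1,2.M_2\}\mid 1\text{`}M\mid2\text{`}M\mid\lambda x{:}A.M\mid V\text{`}M\mid\mathbf{return}\,V\mid M\,\mathbf{to}\,x.\,N\mid\mathbf{match}\,V\,\mathbf{with}\,(x_1,x_2).M\mid\mathbf{if}\,V\,\mathbf{then}\,M_1\,\mathbf{else}\,M_2\mid\mathbf{force}\,V$. Contexts are lists of distinct variables with value types. Value typing $\Gamma\vdash V:A$ is the evident one, with $\Gamma\vdash\mathbf{thunk}\,M:\mathbf U\underline C$ if $\Gamma\vdash_c M:\underline C$. Computation typing $\Gamma\vdash_cM:\underline C$: $\lambda\{1.M_1,2.M_2\}:\underline C_1\underline\times\,\underline C_2$ if $M_i:\underline C_i$; $i\text{`}M:\underline C_i$ if $M:\underline C_1\underline\times\,\underline C_2$; $\lambda x{:}A.M:A\to\underline C$ if $\Gamma,x:A\vdash_cM:\underline C$; $V\text{`}M:\underline C$ if $V:A$, $M:A\to\underline C$ (application of $M$ to $V$); $\mathbf{return}\,V:\mathbf FA$ if $V:A$; $M\,\mathbf{to}\,x.N:\underline C$ if $M:\mathbf FA$ and $\Gamma,x:A\vdash_cN:\underline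 C$; match and if are the evident eliminators of $A_1\times A_2$ and $\mathbf{bool}$ into any $\underline C$; $\mathbf{force}\,V:\underline C$ if $V:\mathbf U\underline C$. Interpretation in a model: $[\![\mathbf{unit}]\!]=1$, $[\![A_1\times A_2]\!]=[\![A_1]\!]\times[\![A_2]\!]$, $[\![\mathbf{bool}]\!]=2$, $[\![\mathbf U\underline C]\!]=U_{\mathsf T}[\![\underline C]\!]$; as $\mathsf T$-algebras, $[\![\underline C_1\underline\times\,\underline C_2]\!]=[\![\underline C_1]\!]\times[\![\underline C_2]\!]$, $[\![A\to\underline C]\!]=[\![A]\!]\Rightarrow[\![\underline C]\!]$, $[\![\mathbf FA]\!]=F_{\mathsf T}[\![A]\!]$; contexts are products. $[\![\Gamma\vdash V:A]\!]:[\![\Gamma]\!]\to[\![A]\!]$ and $[\![\Gamma\vdash_cM:\underline C]\!]:[\![\Gamma]\!]\to U_{\mathsf T}[\![\underline C]\!]$ are: $[\![x]\!]=\pi_x$, $[\![()]\!]=\langle\rangle$, $[\![(V_1,V_2)]\!]=\langle[\![V_1]\!],[\![V_2]\!]\rangle$, $[\![\mathbf{true}]\!]=\mathrm{inl}\circ\langle\rangle$, $[\![\mathbf{false}]\!]=\mathrm{inr}\circ\langle\rangle$, $[\![\mathbf{thunk}\,M]\!]=[\![M]\!]$, $[\![\lambda\{1.M_1,2.M_2\}]\!]=\langle[\![M_1]\!],[\![M_2]\!]\rangle$, $[\![i\text{`}M]\!]=\pi_i\circ[\![M]\!]$, $[\![\lambda x.M]\!]=\Lambda[\![M]\!]$,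 $[\![V\text{`}M]\!]=\Lambda^{-1}[\![M]\!]\circ\langle\mathrm{id},[\![V]\!]\rangle$, $[\![\mathbf{return}\,V]\!]=\eta\circ[\![V]\!]$, $[\![M\,\mathbf{to}\,x.N]\!]=[\![N]\!]^{\ddagger([\![\Gamma]\!]\times\square)}\circ\langle\mathrm{id},[\![M]\!]\rangle$, $[\![\mathbf{match}\,V\,\mathbf{with}\,(x,y).M]\!]=[\![M]\!]\circ\mathrm{assoc}^{-1}\circ\langle\mathrm{id},[\![V]\!]\rangle$, $[\![\mathbf{if}\,V\,\mathbf{then}\,M_1\,\mathbf{else}\,M_2]\!]=[[\![M_1]\!],[\![M_2]\!]]\circ\mathrm{dist}\circ\langle\mathrm{id},[\![V]\!]\rangle$, $[\![\mathbf{force}\,V]\!]=[\![V]\!]$. A program is a closed computation of type $\mathbf F\,\mathbf{bool}$. A program relation is a preorder $\preccurlyeq$ on programs. For $\Gamma\vdash_cM,M':\underline C$, write $M\preccurlyeq_{\mathrm{ctx}}M'$ if $\mathcal E[M]\preccurlyeq\mathcal E[M']$ for every computation context $\mathcal E$ (computation term with a single hole where a computation is expected; filling may capture variables) such that $\mathcal E[M],\mathcal E[M']$ are programs. A model is adequate with respect to $\preccurlyeq$ if $[\![\Gamma\vdash_cM:\underline C]\!]\sqsubseteq[\![\Gamma\vdash_cM':\underline C]\!]$ implies $M\preccurlyeq_{\mathrm{ctx}}M'$, for all such $M,M'$. **Source language.** Types $\tau::=\mathbf{unit}\mid\mathbf{bool}\mid\tau_1\times\tau_2\mid\tau\to\tau'$;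 expressions $e::=x\mid()\mid(e_1,e_2)\mid\mathbf{fst}\,e\mid\mathbf{snd}\,e\mid\mathbf{true}\mid\mathbf{false}\mid\mathbf{if}\,e_0\,\mathbf{then}\,e_1\,\mathbf{else}\,e_2\mid\lambda x{:}\tau.e\mid e\,e'$, with the usual simply typed rules $\Gamma\vdash e:\tau$. **Call-by-value translation.** $\mathcal V(\mathbf{unit})=\mathbf{unit}$, $\mathcal V(\mathbf{bool})=\mathbf{bool}$, $\mathcal V(\tau_1\times\tau_2)=\mathcal V(\tau_1)\times\mathcal V(\tau_2)$, $\mathcal V(\tau\to\tau')=\mathbf U(\mathcal V(\tau)\to\mathbf F\mathcal V(\tau'))$; $\mathcal V(x_1{:}\tau_1,\dots)=x_1{:}\mathcal V(\tau_1),\dots$. For $\Gamma\vdash e:\tau$, $\mathcal V(\Gamma)\vdash_c\mathcal V(e):\mathbf F\mathcal V(\tau)$: $x\mapsto\mathbf{return}\,x$; $()\mapsto\mathbf{return}\,()$; $(e_1,e_2)\mapsto\mathcal V(e_1)\,\mathbf{to}\,z_1.\,\mathcal V(e_2)\,\mathbf{to}\,z_2.\,\mathbf{return}\,(z_1,z_2)$; $\mathbf{fst}\,e\mapsto\mathcal V(e)\,\mathbf{to}\,z.\,\mathbf{match}\,z\,\mathbf{with}\,(z_1,z_2).\mathbf{return}\,z_1$, similarly $\mathbf{snd}$; $\mathbf{true}\mapsto\mathbf{return}\,\mathbf{true}$, $\mathbf{false}\mapsto\mathbf{return}\,\mathbf{false}$; $\mathbf{if}\,e_0\,\mathbf{then}\,e_1\,\mathbf{else}\,e_2\mapsto\mathcal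 V(e_0)\,\mathbf{to}\,z.\,\mathbf{if}\,z\,\mathbf{then}\,\mathcal V(e_1)\,\mathbf{else}\,\mathcal V(e_2)$; $\lambda x{:}\tau.e\mapsto\mathbf{return}\,\mathbf{thunk}\,\lambda x{:}\mathcal V(\tau).\mathcal V(e)$; $e\,e'\mapsto\mathcal V(e)\,\mathbf{to}\,y.\,\mathcal V(e')\,\mathbf{to}\,z.\,z\text{`}\mathbf{force}\,y$. **Call-by-name translation.** $\mathcal N(\mathbf{unit})=\mathbf F\,\mathbf{unit}$, $\mathcal N(\mathbf{bool})=\mathbf F\,\mathbf{bool}$, $\mathcal N(\tau_1\times\tau_2)=\mathcal N(\tau_1)\underline\times\,\mathcal N(\tau_2)$, $\mathcal N(\tau\to\tau')=\mathbf U\mathcal N(\tau)\to\mathcal N(\tau')$; $\mathcal N(x_1{:}\tau_1,\dots)=x_1{:}\mathbf U\mathcal N(\tau_1),\dots$. For $\Gamma\vdash e:\tau$, $\mathcal N(\Gamma)\vdash_c\mathcal N(e):\mathcal N(\tau)$: $x\mapsto\mathbf{force}\,x$; $()\mapsto\mathbf{return}\,()$; $(e_1,e_2)\mapsto\lambda\{1.\mathcal N(e_1),2.\mathcal N(e_2)\}$; $\mathbf{fst}\,e\mapsto1\text{`}\mathcal N(e)$; $\mathbf{snd}\,e\mapsto2\text{`}\mathcal N(e)$; $\mathbf{true}\mapsto\mathbf{return}\,\mathbf{true}$, $\mathbf{false}\mapsto\mathbf{return}\,\mathbf{false}$; $\mathbf{if}\,e_0\,\mathbf{then}\,e_1\,\mathbf{else}\,e_2\mapsto\mathcal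 N(e_0)\,\mathbf{to}\,z.\,\mathbf{if}\,z\,\mathbf{then}\,\mathcal N(e_1)\,\mathbf{else}\,\mathcal N(e_2)$; $\lambda x{:}\tau.e\mapsto\lambda x{:}\mathbf U\mathcal N(\tau).\mathcal N(e)$; $e\,e'\mapsto(\mathbf{thunk}\,\mathcal N(e'))\text{`}\mathcal N(e)$. (Auxiliary variables are fresh.) For closed $e:\mathbf{bool}$, both $\mathcal V(e)$ and $\mathcal N(e)$ are programs. *)

(* Defs.v *)
From Stdlib Require Import List RelationClasses.
Import ListNotations.

Set Implicit Arguments.
Unset Strict Implicit.
Unset Printing Implicit Defensive.

Declare Scope cat_scope.
Delimit Scope cat_scope with cat.
Local Open Scope cat_scope.

Record poset_category := PosetCategory {
  ob :> Type;
  hom : ob -> ob -> Type;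
  hle : forall X Y, hom X Y -> hom X Y -> Prop;
  idm : forall X, hom X X;
  comp : forall X Y Z, hom Y Z -> hom X Y -> hom X Z;
  hle_preorder : forall X Y, PreOrder (@hle X Y);
  hle_antisym : forall X Y (f g : hom X Y), hle f g -> hle g f -> f = g;
  comp_idl : forall X Y (f : hom X Y), comp (idm Y) f = f;
  comp_idr : forall X Y (f : hom X Y), comp f (idm X) = f;
  comp_assoc : forall X Y Z V (h : hom Z V) (g : hom Y Z) (f : hom X Y),
    comp (comp h g) f = comp h (comp g f);
  comp_mono : forall X Y Z (g g' : hom Y Z) (f f' : hom X Y),
    hle g g' -> hle f f' -> hle (comp g f) (comp g' f')
}.
Arguments hom {_} _ _.
Arguments hle {_ _ _} _ _.
Arguments idm {_} _.
Arguments comp {_ _ _ _} _ _.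

Notation "f ⊑ g" := (hle f g) (at level 70, no associativity) : cat_scope.
Notation "g ∘ f" := (comp g f) (at level 40, left associativity) : cat_scope.

Record cartesian_category := CartesianCategory {
  cart_cat :> poset_category;
  one : cart_cat;
  bang : forall X : cart_cat, hom X one;
  bang_unique : forall (X : cart_cat) (f : hom X one), f = bang X;
  prd : cart_cat -> cart_cat -> cart_cat;
  fstm : forall X Y, hom (prd X Y) X;
  sndm : forall X Y, hom (prd X Y) Y;
  pairm : forall W X Y, hom W X -> hom W Y -> hom W (prd X Y);
  fst_pair : forall W X Y (f : hom W X) (g : hom W Y),
    fstm X Y ∘ pairm f g = f;
  snd_pair : forall W X Y (f : hom W X) (g : hom W Y),
    sndm X Y ∘ pairm f g = g;
  pair_unique : forall W X Y (h : hom W (prd X Y)),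
    pairm (fstm X Y ∘ h) (sndm X Y ∘ h) = h;
  pair_mono : forall W X Y (f f' : hom W X) (g g' : hom W Y),
    f ⊑ f' -> g ⊑ g' -> pairm f g ⊑ pairm f' g'
}.
Arguments one {_}.
Arguments bang {_} _.
Arguments prd {_} _ _.
Arguments fstm {_} {_ _}.
Arguments sndm {_} {_ _}.
Arguments pairm {_ _ _ _} _ _.

Notation "X × Y" := (prd X Y) (at level 40, left associativity) : cat_scope.
Notation "⟨ f , g ⟩" := (pairm f g) (at level 0) : cat_scope.

Section Cartesian.
Context {C : cartesian_category}.
Implicit Types W X Y Z : C.

Definition times {X X' Y Y'} (f : hom X X') (g : hom Y Y') :
  hom (X × Y) (X' × Y') := ⟨f ∘ fstm, g ∘ sndm⟩.

Definition assoc X1 X2 X3 : hom ((X1 × X2) × X3) (X1 × (X2 × X3)) :=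
  ⟨fstm ∘ fstm, ⟨sndm ∘ fstm, sndm⟩⟩.

Definition assoc_inv X1 X2 X3 : hom (X1 × (X2 × X3)) ((X1 × X2) × X3) :=
  ⟨⟨fstm, fstm ∘ sndm⟩, sndm ∘ sndm⟩.

Definition swap X1 X2 : hom (X1 × X2) (X2 × X1) := ⟨sndm, fstm⟩.

Definition beta X1 X2 X3 : hom ((X1 × X2) × X3) ((X1 × X3) × X2) :=
  ⟨⟨fstm ∘ fstm, sndm⟩, sndm ∘ fstm⟩.

End Cartesian.
Arguments assoc {_} {_ _ _}.
Arguments assoc_inv {_} {_ _ _}.
Arguments swap {_} {_ _}.
Arguments beta {_} {_ _ _}.

Notation "f ⊗ g" := (times f g) (at level 40, left associativity) : cat_scope.

Record cartesian_closed_category := CartesianClosedCategory {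
  ccc_cart :> cartesian_category;
  expo : ccc_cart -> ccc_cart -> ccc_cart;
  ev : forall X Y, hom (expo X Y × X) Y;
  curry : forall W X Y, hom (W × X) Y -> hom W (expo X Y);
  ev_curry : forall W X Y (f : hom (W × X) Y),
    ev X Y ∘ (curry f ⊗ idm X) = f;
  curry_unique : forall W X Y (g : hom W (expo X Y)),
    curry (ev X Y ∘ (g ⊗ idm X)) = g;
  curry_mono : forall W X Y (f f' : hom (W × X) Y),
    f ⊑ f' -> curry f ⊑ curry f'
}.
Arguments expo {_} _ _.
Arguments ev {_} {_ _}.
Arguments curry {_ _ _ _} _.

Notation "X ⇒ Y" := (expo X Y) (at level 45, right associativity) : cat_scope.

Definition uncurry {C : cartesian_closed_category} {W X Y : C}
  (g : hom W (X ⇒ Y)) : hom (W × X) Y := ev ∘ (g ⊗ idm X).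

Record coproduct (C : poset_category) (X Y : C) := Coproduct {
  sum_ob :> C;
  inlm : hom X sum_ob;
  inrm : hom Y sum_ob;
  copair : forall Z, hom X Z -> hom Y Z -> hom sum_ob Z;
  copair_inl : forall Z (f : hom X Z) (g : hom Y Z), copair f g ∘ inlm = f;
  copair_inr : forall Z (f : hom X Z) (g : hom Y Z), copair f g ∘ inrm = g;
  copair_unique : forall Z (h : hom sum_ob Z),
    copair (h ∘ inlm) (h ∘ inrm) = h;
  copair_mono : forall Z (f f' : hom X Z) (g g' : hom Y Z),
    f ⊑ f' -> g ⊑ g' -> copair f g ⊑ copair f' g'
}.
Arguments inlm {_ _ _ _}.
Arguments inrm {_ _ _ _}.
Arguments copair {_ _ _} _ {_} _ _.

Section CartesianLemmas.
Context {C : cartesian_category}.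
Implicit Types V W X Y Z : C.

Lemma hle_refl {X Y} (f : hom X Y) : f ⊑ f.
Proof. apply (hle_preorder X Y). Qed.

Lemma fst_pair_comp {V W X Y} (f : hom W X) (g : hom W Y) (h : hom V W) :
  fstm ∘ (⟨f, g⟩ ∘ h) = f ∘ h.
Proof. now rewrite <- comp_assoc, fst_pair. Qed.

Lemma snd_pair_comp {V W X Y} (f : hom W X) (g : hom W Y) (h : hom V W) :
  sndm ∘ (⟨f, g⟩ ∘ h) = g ∘ h.
Proof. now rewrite <- comp_assoc, snd_pair. Qed.

Lemma pair_comp {V W X Y} (f : hom W X) (g : hom W Y) (h : hom V W) :
  ⟨f, g⟩ ∘ h = ⟨f ∘ h, g ∘ h⟩.
Proof.
rewrite <- (pair_unique (⟨f, g⟩ ∘ h)), <- !comp_assoc.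
now rewrite fst_pair, snd_pair.
Qed.

Lemma pair_fst_snd X Y : ⟨@fstm C X Y, sndm⟩ = idm (X × Y).
Proof. now rewrite <- (pair_unique (idm (X × Y))), !comp_idr. Qed.

Lemma bang_eq {X} (f g : hom X (@one C)) : f = g.
Proof. now rewrite (bang_unique f), (bang_unique g). Qed.

End CartesianLemmas.

Ltac cart :=
  unfold times, assoc, assoc_inv, swap, beta;
  repeat progress rewrite ?comp_assoc, ?comp_idl, ?comp_idr, ?pair_comp,
    ?fst_pair, ?snd_pair, ?fst_pair_comp, ?snd_pair_comp, ?pair_unique,
    ?pair_fst_snd.

Section ClosedLemmas.
Context {C : cartesian_closed_category}.
Implicit Types V W X Y Z : C.

Lemma uncurry_curry {W X Y} (f : hom (W × X) Y) : uncurry (curry f) = f.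
Proof. apply ev_curry. Qed.

Lemma curry_uncurry {W X Y} (g : hom W (X ⇒ Y)) : curry (uncurry g) = g.
Proof. apply curry_unique. Qed.

Lemma uncurry_comp {V W X Y} (g : hom W (X ⇒ Y)) (h : hom V W) :
  uncurry (g ∘ h) = uncurry g ∘ (h ⊗ idm X).
Proof. unfold uncurry. rewrite comp_assoc. f_equal. now cart. Qed.

Lemma curry_comp {V W X Y} (f : hom (W × X) Y) (h : hom V W) :
  curry f ∘ h = curry (f ∘ (h ⊗ idm X)).
Proof.
rewrite <- (curry_uncurry (curry f ∘ h)). f_equal.
now rewrite uncurry_comp, uncurry_curry.
Qed.

Lemma uncurry_mono {W X Y} (g g' : hom W (X ⇒ Y)) :
  g ⊑ g' -> uncurry g ⊑ uncurry g'.
Proof.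
intros H. unfold uncurry, times.
apply comp_mono; [apply hle_refl|].
apply pair_mono; [|apply hle_refl].
apply comp_mono; [exact H|apply hle_refl].
Qed.

End ClosedLemmas.

Section Distributivity.
Context {C : cartesian_closed_category} (two : coproduct (@one C) (@one C)).
Variable W : C.

Definition dbl_inl : hom W (W × two) := ⟨idm W, inlm ∘ bang W⟩.
Definition dbl_inr : hom W (W × two) := ⟨idm W, inrm ∘ bang W⟩.

Definition dbl_copair Z (f g : hom W Z) : hom (W × two) Z :=
  uncurry (copair two (curry (f ∘ sndm)) (curry (g ∘ sndm))) ∘ swap.

Lemma dbl_copair_inl Z (f g : hom W Z) : dbl_copair f g ∘ dbl_inl = f.
Proof.
unfold dbl_copair, dbl_inl.
transitivity (uncurry (copair two (curry (f ∘ sndm)) (curry (g ∘ sndm)))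
  ∘ (inlm ⊗ idm W) ∘ ⟨bang W, idm W⟩).
- rewrite !comp_assoc. f_equal. now cart.
- rewrite <- uncurry_comp, copair_inl, uncurry_curry. now cart.
Qed.

Lemma dbl_copair_inr Z (f g : hom W Z) : dbl_copair f g ∘ dbl_inr = g.
Proof.
unfold dbl_copair, dbl_inr.
transitivity (uncurry (copair two (curry (f ∘ sndm)) (curry (g ∘ sndm)))
  ∘ (inrm ⊗ idm W) ∘ ⟨bang W, idm W⟩).
- rewrite !comp_assoc. f_equal. now cart.
- rewrite <- uncurry_comp, copair_inr, uncurry_curry. now cart.
Qed.

Lemma dbl_copair_unique Z (h : hom (W × two) Z) :
  dbl_copair (h ∘ dbl_inl) (h ∘ dbl_inr) = h.
Proof.
unfold dbl_copair.
replace (curry (h ∘ dbl_inl ∘ sndm)) with (curry (h ∘ swap) ∘ inlm (c := two)).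
replace (curry (h ∘ dbl_inr ∘ sndm)) with (curry (h ∘ swap) ∘ inrm (c := two)).
- rewrite copair_unique, uncurry_curry. now cart.
- rewrite curry_comp. unfold dbl_inr. f_equal. rewrite !comp_assoc. f_equal.
  cart. now rewrite (bang_eq (bang W ∘ sndm) fstm).
- rewrite curry_comp. unfold dbl_inl. f_equal. rewrite !comp_assoc. f_equal.
  cart. now rewrite (bang_eq (bang W ∘ sndm) fstm).
Qed.

Lemma dbl_copair_mono Z (f f' g g' : hom W Z) :
  f ⊑ f' -> g ⊑ g' -> dbl_copair f g ⊑ dbl_copair f' g'.
Proof.
intros Hf Hg. unfold dbl_copair.
apply comp_mono; [|apply hle_refl]. apply uncurry_mono, copair_mono;
  apply curry_mono; apply comp_mono; auto using hle_refl.
Qed.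

(** In a cartesian closed category [W × 2] is itself a coproduct of [W] with
    [W].  With this choice of [W + W] the canonical map to [W × 2], and hence
    its inverse [dist], is the identity; see [dist_canonicalK] and
    [dist_canonicalVK]. *)
Definition dbl : coproduct W W :=
  @Coproduct C W W (W × two) dbl_inl dbl_inr dbl_copair dbl_copair_inl
    dbl_copair_inr dbl_copair_unique dbl_copair_mono.

Definition dist_canonical : hom dbl (W × two) :=
  copair dbl ⟨idm W, inlm ∘ bang W⟩ ⟨idm W, inrm ∘ bang W⟩.

Definition dist : hom (W × two) dbl := idm (W × two).

Lemma dist_canonicalK : dist ∘ dist_canonical = idm dbl.
Proof.
unfold dist, dist_canonical.
transitivity (copair dbl (idm dbl ∘ inlm) (idm dbl ∘ inrm)).
- now rewrite !comp_idl.
- apply copair_unique.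
Qed.

Lemma dist_canonicalVK : dist_canonical ∘ dist = idm (W × two).
Proof.
unfold dist. rewrite comp_idr.
transitivity (dist ∘ dist_canonical); [|exact dist_canonicalK].
symmetry. apply comp_idl.
Qed.

End Distributivity.

(** [mext f] is the extension written f^{†(W × □)}, and [aext f] below is
    f^{‡(W × □)}. *)
Record strong_monad (C : cartesian_category) := StrongMonad {
  mob :> C -> C;
  eta : forall X, hom X (mob X);
  mext : forall W X Y, hom (W × X) (mob Y) -> hom (W × mob X) (mob Y);
  mext_mono : forall W X Y (f f' : hom (W × X) (mob Y)),
    f ⊑ f' -> mext f ⊑ mext f';
  mext_nat : forall W' W X Y (f : hom (W × X) (mob Y)) (w : hom W' W),
    mext f ∘ (w ⊗ idm (mob X)) = mext (f ∘ (w ⊗ idm X));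
  mext_eta : forall W X Y (f : hom (W × X) (mob Y)),
    mext f ∘ (idm W ⊗ eta X) = f;
  eta_mext : forall X, mext (eta X ∘ @sndm C one X) = sndm;
  mext_assoc : forall W' W X Y Z
    (f : hom (W × X) (mob Y)) (g : hom (W' × Y) (mob Z)),
    mext (mext g ∘ (idm W' ⊗ f) ∘ assoc) = mext g ∘ (idm W' ⊗ mext f) ∘ assoc
}.
Arguments eta {_ _} _.
Arguments mext {_} _ {_ _ _} _.

Record algebra (C : cartesian_category) (T : strong_monad C) := Algebra {
  carrier :> C;
  aext : forall W X, hom (W × X) carrier -> hom (W × T X) carrier;
  aext_mono : forall W X (f f' : hom (W × X) carrier),
    f ⊑ f' -> aext f ⊑ aext f';
  aext_nat : forall W' W X (f : hom (W × X) carrier) (w : hom W' W),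
    aext f ∘ (w ⊗ idm (T X)) = aext (f ∘ (w ⊗ idm X));
  aext_eta : forall W X (f : hom (W × X) carrier),
    aext f ∘ (idm W ⊗ eta X) = f;
  aext_assoc : forall W' W X Y
    (f : hom (W × X) (T Y)) (g : hom (W' × Y) carrier),
    aext (aext g ∘ (idm W' ⊗ f) ∘ assoc)
    = aext g ∘ (idm W' ⊗ mext T f) ∘ assoc
}.
Arguments aext {_ _} _ {_ _} _.

Section Derived.
Context {C : cartesian_category} (T : strong_monad C).
Implicit Types W X Y : C.

Definition ext {X Y} (f : hom X (T Y)) : hom (T X) (T Y) :=
  mext T (f ∘ @sndm C one X) ∘ ⟨bang (T X), idm (T X)⟩.

Definition mmap {X Y} (f : hom X Y) : hom (T X) (T Y) := ext (eta Y ∘ f).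

(** f^{†(□ × W)} *)
Definition mextl {W X Y} (f : hom (X × W) (T Y)) : hom (T X × W) (T Y) :=
  mext T (f ∘ swap) ∘ swap.

Definition seqL X1 X2 : hom (T X1 × T X2) (T (X1 × X2)) :=
  mextl (mext T (eta (X1 × X2))).

Definition seqR X1 X2 : hom (T X1 × T X2) (T (X1 × X2)) :=
  mext T (mextl (eta (X1 × X2))).

Definition lax_discardable {X Y} (f : hom X (T Y)) : Prop :=
  mmap (bang Y) ∘ f ⊑ eta one ∘ bang X.

Definition lax_copyable {X Y} (f : hom X (T Y)) : Prop :=
  mmap ⟨idm Y, idm Y⟩ ∘ f ⊑ seqL Y Y ∘ ⟨f, f⟩.

Definition lax_central {X Y} (f : hom X (T Y)) : Prop :=
  forall W, seqL Y W ∘ (f ⊗ idm (T W)) ⊑ seqR Y W ∘ (f ⊗ idm (T W)).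

Definition free_algebra X : algebra T :=
  @Algebra C T (T X) (fun W Y => @mext C T W Y X)
    (fun W Y => @mext_mono C T W Y X)
    (fun W' W Y => @mext_nat C T W' W Y X)
    (fun W Y => @mext_eta C T W Y X)
    (fun W' W Y Y' => @mext_assoc C T W' W Y Y' X).

End Derived.

Section ProductAlgebra.
Context {C : cartesian_category} {T : strong_monad C} (Z1 Z2 : algebra T).

Definition prod_aext W X (f : hom (W × X) (Z1 × Z2)) :
  hom (W × T X) (Z1 × Z2) := ⟨aext Z1 (fstm ∘ f), aext Z2 (sndm ∘ f)⟩.

Lemma prod_aext_mono W X (f f' : hom (W × X) (Z1 × Z2)) :
  f ⊑ f' -> prod_aext f ⊑ prod_aext f'.
Proof.
intros H. apply pair_mono; apply aext_mono; apply comp_mono;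
  auto using hle_refl.
Qed.

Lemma prod_aext_nat W' W X (f : hom (W × X) (Z1 × Z2)) (w : hom W' W) :
  prod_aext f ∘ (w ⊗ idm (T X)) = prod_aext (f ∘ (w ⊗ idm X)).
Proof. unfold prod_aext. now rewrite pair_comp, !aext_nat, !comp_assoc. Qed.

Lemma prod_aext_eta W X (f : hom (W × X) (Z1 × Z2)) :
  prod_aext f ∘ (idm W ⊗ eta X) = f.
Proof. unfold prod_aext. now rewrite pair_comp, !aext_eta, pair_unique. Qed.

Lemma prod_aext_assoc W' W X Y
    (f : hom (W × X) (T Y)) (g : hom (W' × Y) (Z1 × Z2)) :
  prod_aext (prod_aext g ∘ (idm W' ⊗ f) ∘ assoc)
  = prod_aext g ∘ (idm W' ⊗ mext T f) ∘ assoc.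
Proof.
unfold prod_aext.
now rewrite !pair_comp, fst_pair, snd_pair, !aext_assoc.
Qed.

Definition prod_algebra : algebra T :=
  @Algebra C T (Z1 × Z2) prod_aext prod_aext_mono prod_aext_nat
    prod_aext_eta prod_aext_assoc.

End ProductAlgebra.

Section PowerAlgebra.
Context {C : cartesian_closed_category} {T : strong_monad C}.
Variables (P : C) (Z : algebra T).

Definition power_aext W X (f : hom (W × X) (P ⇒ Z)) :
  hom (W × T X) (P ⇒ Z) :=
  curry (aext Z (uncurry f ∘ @beta C W P X) ∘ @beta C W (T X) P).

Lemma power_aext_mono W X (f f' : hom (W × X) (P ⇒ Z)) :
  f ⊑ f' -> power_aext f ⊑ power_aext f'.
Proof.
intros H. apply curry_mono, comp_mono; [|apply hle_refl].
apply aext_mono, comp_mono; [|apply hle_refl]. now apply uncurry_mono.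
Qed.

Lemma power_aext_nat W' W X (f : hom (W × X) (P ⇒ Z)) (w : hom W' W) :
  power_aext f ∘ (w ⊗ idm (T X)) = power_aext (f ∘ (w ⊗ idm X)).
Proof.
unfold power_aext. rewrite curry_comp, uncurry_comp. f_equal.
transitivity (aext Z (uncurry f ∘ beta) ∘ ((w ⊗ idm P) ⊗ idm (T X)) ∘ beta).
- rewrite !comp_assoc. f_equal. now cart.
- rewrite aext_nat. f_equal. f_equal. rewrite !comp_assoc. f_equal. now cart.
Qed.

Lemma power_aext_eta W X (f : hom (W × X) (P ⇒ Z)) :
  power_aext f ∘ (idm W ⊗ eta X) = f.
Proof.
unfold power_aext. rewrite curry_comp.
transitivity (curry (aext Z (uncurry f ∘ beta) ∘ (idm (W × P) ⊗ eta X)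
  ∘ @beta C W X P)).
- f_equal. rewrite !comp_assoc. f_equal. now cart.
- rewrite aext_eta. rewrite <- (curry_uncurry f) at 2. f_equal. now cart.
Qed.

Lemma power_aext_assoc W' W X Y
    (f : hom (W × X) (T Y)) (g : hom (W' × Y) (P ⇒ Z)) :
  power_aext (power_aext g ∘ (idm W' ⊗ f) ∘ assoc)
  = power_aext g ∘ (idm W' ⊗ mext T f) ∘ assoc.
Proof.
unfold power_aext at 1. unfold power_aext at 2.
rewrite !uncurry_comp. unfold power_aext. rewrite uncurry_curry, !curry_comp.
f_equal. set (h := uncurry g ∘ beta).
transitivity (aext Z (aext Z h ∘ (idm (W' × P) ⊗ f) ∘ assoc
  ∘ (@beta C W' W P ⊗ idm X)) ∘ beta).
- f_equal. f_equal. rewrite !comp_assoc. f_equal. now cart.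
- rewrite <- aext_nat, aext_assoc, !comp_assoc. f_equal. now cart.
Qed.

Definition power_algebra : algebra T :=
  @Algebra C T (P ⇒ Z) power_aext power_aext_mono power_aext_nat
    power_aext_eta power_aext_assoc.

End PowerAlgebra.

Record cbpv_model := CBPVModel {
  model_cat :> cartesian_closed_category;
  model_two : coproduct (@one model_cat) (@one model_cat);
  model_monad : strong_monad model_cat
}.

Inductive vty : Type :=
| vunit
| vprod (A1 A2 : vty)
| vbool
| vU (B : cty)
with cty : Type :=
| cprod (B1 B2 : cty)
| carr (A : vty) (B : cty)
| cF (A : vty).

(** Terms are intrinsically typed with de Bruijn indices: the most recently
    bound variable is the head of the context. *)
Inductive var {ty : Type} : list ty -> ty -> Type :=
| vz G A : var (A :: G) A
| vs G A A' : var G A -> var (A' :: G) A.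
Arguments vz {ty G A}.
Arguments vs {ty G A A'} _.

Inductive val : list vty -> vty -> Type :=
| Var G A : var G A -> val G A
| Unit G : val G vunit
| Pair G A1 A2 : val G A1 -> val G A2 -> val G (vprod A1 A2)
| True_ G : val G vbool
| False_ G : val G vbool
| Thunk G B : cmp G B -> val G (vU B)
with cmp : list vty -> cty -> Type :=
| LamPair G B1 B2 : cmp G B1 -> cmp G B2 -> cmp G (cprod B1 B2)
| Proj1 G B1 B2 : cmp G (cprod B1 B2) -> cmp G B1
| Proj2 G B1 B2 : cmp G (cprod B1 B2) -> cmp G B2
| Lam G A B : cmp (A :: G) B -> cmp G (carr A B)
| App G A B : val G A -> cmp G (carr A B) -> cmp G B
| Return G A : val G A -> cmp G (cF A)
| To G A B : cmp G (cF A) -> cmp (A :: G) B -> cmp G B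
| Match G A1 A2 B : val G (vprod A1 A2) -> cmp (A2 :: A1 :: G) B -> cmp G B
| If G B : val G vbool -> cmp G B -> cmp G B -> cmp G B
| Force G B : val G (vU B) -> cmp G B.

Definition renaming (G D : list vty) : Type := forall A, var G A -> var D A.

Definition lift {G D} A0 (r : renaming G D) : renaming (A0 :: G) (A0 :: D) :=
  fun A x =>
    match x in var G' A' return
      match G' with
      | [] => unit
      | A0' :: G'' => (forall A, var G'' A -> var D A) -> var (A0' :: D) A'
      end
    with
    | vz => fun _ => vz
    | vs x' => fun r' => vs (r' _ x')
    end r.

Fixpoint ren_val {G A} (V : val G A) : forall D, renaming G D -> val D A :=
  match V with
  | Var x => fun D r => Var (r _ x)
  | Unit _ => fun D r => Unit D
  | Pair V1 V2 => fun D r => Pair (ren_val V1 r) (ren_val V2 r)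
  | True_ _ => fun D r => True_ D
  | False_ _ => fun D r => False_ D
  | Thunk M => fun D r => Thunk (ren_cmp M r)
  end
with ren_cmp {G B} (M : cmp G B) : forall D, renaming G D -> cmp D B :=
  match M with
  | LamPair M1 M2 => fun D r => LamPair (ren_cmp M1 r) (ren_cmp M2 r)
  | Proj1 M => fun D r => Proj1 (ren_cmp M r)
  | Proj2 M => fun D r => Proj2 (ren_cmp M r)
  | Lam M => fun D r => Lam (ren_cmp M (lift r))
  | App V M => fun D r => App (ren_val V r) (ren_cmp M r)
  | Return V => fun D r => Return (ren_val V r)
  | To M N => fun D r => To (ren_cmp M r) (ren_cmp N (lift r))
  | Match V M => fun D r => Match (ren_val V r) (ren_cmp M (lift (lift r)))
  | If V M1 M2 =>
      fun D r => If (ren_val V r) (ren_cmp M1 r) (ren_cmp M2 r)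
  | Force V => fun D r => Force (ren_val V r)
  end.

Definition weaken {G B} A (M : cmp G B) : cmp (A :: G) B :=
  ren_cmp M (fun _ x => vs x).

(** [kval G B D A] and [kcmp G B D B'] are values and computations in context
    [D] with one hole for a computation typed [G ⊢ B].  The context at the hole
    is [G], i.e. [D] extended by the binders above the hole, so [fill_cmp] can
    plug a term in without renaming: its free variables are captured. *)
Inductive kval (G : list vty) (B : cty) : list vty -> vty -> Type :=
| KPair1 D A1 A2 : kval G B D A1 -> val D A2 -> kval G B D (vprod A1 A2)
| KPair2 D A1 A2 : val D A1 -> kval G B D A2 -> kval G B D (vprod A1 A2)
| KThunk D B' : kcmp G B D B' -> kval G B D (vU B')
with kcmp (G : list vty) (B : cty) : list vty -> cty -> Type :=
| KHole : kcmp G B G B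
| KLamPair1 D B1 B2 :
    kcmp G B D B1 -> cmp D B2 -> kcmp G B D (cprod B1 B2)
| KLamPair2 D B1 B2 :
    cmp D B1 -> kcmp G B D B2 -> kcmp G B D (cprod B1 B2)
| KProj1 D B1 B2 : kcmp G B D (cprod B1 B2) -> kcmp G B D B1
| KProj2 D B1 B2 : kcmp G B D (cprod B1 B2) -> kcmp G B D B2
| KLam D A B' : kcmp G B (A :: D) B' -> kcmp G B D (carr A B')
| KApp1 D A B' : kval G B D A -> cmp D (carr A B') -> kcmp G B D B'
| KApp2 D A B' : val D A -> kcmp G B D (carr A B') -> kcmp G B D B'
| KReturn D A : kval G B D A -> kcmp G B D (cF A)
| KTo1 D A B' : kcmp G B D (cF A) -> cmp (A :: D) B' -> kcmp G B D B'
| KTo2 D A B' : cmp D (cF A) -> kcmp G B (A :: D) B' -> kcmp G B D B'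
| KMatch1 D A1 A2 B' :
    kval G B D (vprod A1 A2) -> cmp (A2 :: A1 :: D) B' -> kcmp G B D B'
| KMatch2 D A1 A2 B' :
    val D (vprod A1 A2) -> kcmp G B (A2 :: A1 :: D) B' -> kcmp G B D B'
| KIf0 D B' : kval G B D vbool -> cmp D B' -> cmp D B' -> kcmp G B D B'
| KIf1 D B' : val D vbool -> kcmp G B D B' -> cmp D B' -> kcmp G B D B'
| KIf2 D B' : val D vbool -> cmp D B' -> kcmp G B D B' -> kcmp G B D B'
| KForce D B' : kval G B D (vU B') -> kcmp G B D B'.
Arguments KHole {G B}.

Fixpoint fill_val {G B D A} (E : kval G B D A) (M : cmp G B) : val D A :=
  match E with
  | KPair1 E V => Pair (fill_val E M) V
  | KPair2 V E => Pair V (fill_val E M)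
  | KThunk E => Thunk (fill_cmp E M)
  end
with fill_cmp {G B D B'} (E : kcmp G B D B') (M : cmp G B) : cmp D B' :=
  match E with
  | KHole => M
  | KLamPair1 E N => LamPair (fill_cmp E M) N
  | KLamPair2 N E => LamPair N (fill_cmp E M)
  | KProj1 E => Proj1 (fill_cmp E M)
  | KProj2 E => Proj2 (fill_cmp E M)
  | KLam E => Lam (fill_cmp E M)
  | KApp1 E N => App (fill_val E M) N
  | KApp2 V E => App V (fill_cmp E M)
  | KReturn E => Return (fill_val E M)
  | KTo1 E N => To (fill_cmp E M) N
  | KTo2 N E => To N (fill_cmp E M)
  | KMatch1 E N => Match (fill_val E M) N
  | KMatch2 V E => Match V (fill_cmp E M)
  | KIf0 E N1 N2 => If (fill_val E M) N1 N2
  | KIf1 V E N => If V (fill_cmp E M) N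
  | KIf2 V N E => If V N (fill_cmp E M)
  | KForce E => Force (fill_val E M)
  end.

Definition program : Type := cmp [] (cF vbool).

Definition program_relation (R : program -> program -> Prop) : Prop :=
  PreOrder R.

Definition ctx_le (R : program -> program -> Prop) {G B} (M M' : cmp G B) :
  Prop :=
  forall E : kcmp G B [] (cF vbool), R (fill_cmp E M) (fill_cmp E M').

Section Interpretation.
Context (Mod : cbpv_model).
Let T := model_monad Mod.
Let two := model_two Mod.

Fixpoint den_vty (A : vty) : Mod :=
  match A with
  | vunit => one
  | vprod A1 A2 => den_vty A1 × den_vty A2
  | vbool => two
  | vU B => carrier (den_cty B)
  end
with den_cty (B : cty) : algebra T :=
  match B with
  | cprod B1 B2 => prod_algebra (den_cty B1) (den_cty B2)
  | carr A B => power_algebra (den_vty A) (den_cty B)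
  | cF A => free_algebra T (den_vty A)
  end.

Fixpoint den_ctx (G : list vty) : Mod :=
  match G with
  | [] => one
  | A :: G => den_ctx G × den_vty A
  end.

Fixpoint den_var {G A} (x : var G A) : hom (den_ctx G) (den_vty A) :=
  match x in var G A return hom (den_ctx G) (den_vty A) with
  | vz => sndm
  | vs x => den_var x ∘ fstm
  end.

Fixpoint den_val {G A} (V : val G A) : hom (den_ctx G) (den_vty A) :=
  match V in val G A return hom (den_ctx G) (den_vty A) with
  | Var x => den_var x
  | Unit G => bang (den_ctx G)
  | Pair V1 V2 => ⟨den_val V1, den_val V2⟩
  | True_ G => inlm ∘ bang (den_ctx G)
  | False_ G => inrm ∘ bang (den_ctx G)
  | Thunk M => den_cmp M
  end
with den_cmp {G B} (M : cmp G B) : hom (den_ctx G) (den_cty B) :=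
  match M in cmp G B return hom (den_ctx G) (den_cty B) with
  | LamPair M1 M2 => ⟨den_cmp M1, den_cmp M2⟩
  | Proj1 M => fstm ∘ den_cmp M
  | Proj2 M => sndm ∘ den_cmp M
  | Lam M => curry (den_cmp M)
  | App V M => uncurry (den_cmp M) ∘ ⟨idm _, den_val V⟩
  | Return V => eta _ ∘ den_val V
  | To M N => aext (den_cty _) (den_cmp N) ∘ ⟨idm _, den_cmp M⟩
  | Match V M => den_cmp M ∘ assoc_inv ∘ ⟨idm _, den_val V⟩
  | If V M1 M2 =>
      copair (dbl two _) (den_cmp M1) (den_cmp M2)
        ∘ dist two _ ∘ ⟨idm _, den_val V⟩
  | Force V => den_val V
  end.

Definition adequate (R : program -> program -> Prop) : Prop :=
  forall G B (M M' : cmp G B), den_cmp M ⊑ den_cmp M' -> ctx_le R M M'.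

End Interpretation.

Inductive sty : Type :=
| sunit
| sbool
| sprod (t1 t2 : sty)
| sarr (t t' : sty).

Inductive exp : list sty -> sty -> Type :=
| EVar G t : var G t -> exp G t
| EUnit G : exp G sunit
| EPair G t1 t2 : exp G t1 -> exp G t2 -> exp G (sprod t1 t2)
| EFst G t1 t2 : exp G (sprod t1 t2) -> exp G t1
| ESnd G t1 t2 : exp G (sprod t1 t2) -> exp G t2
| ETrue G : exp G sbool
| EFalse G : exp G sbool
| EIf G t : exp G sbool -> exp G t -> exp G t -> exp G t
| ELam G t t' : exp (t :: G) t' -> exp G (sarr t t')
| EApp G t t' : exp G (sarr t t') -> exp G t -> exp G t'.

Fixpoint var_map {ty ty' : Type} (h : ty -> ty') {G t} (x : var G t) :
  var (map h G) (h t) :=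
  match x in var G t return var (map h G) (h t) with
  | vz => vz
  | vs x => vs (var_map h x)
  end.

Fixpoint cbv_ty (t : sty) : vty :=
  match t with
  | sunit => vunit
  | sbool => vbool
  | sprod t1 t2 => vprod (cbv_ty t1) (cbv_ty t2)
  | sarr t t' => vU (carr (cbv_ty t) (cF (cbv_ty t')))
  end.

Fixpoint cbv {G t} (e : exp G t) : cmp (map cbv_ty G) (cF (cbv_ty t)) :=
  match e in exp G t return cmp (map cbv_ty G) (cF (cbv_ty t)) with
  | EVar x => Return (Var (var_map cbv_ty x))
  | EUnit _ => Return (Unit _)
  | EPair e1 e2 =>
      To (cbv e1) (To (weaken _ (cbv e2))
        (Return (Pair (Var (vs vz)) (Var vz))))
  | EFst e => To (cbv e) (Match (Var vz) (Return (Var (vs vz))))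
  | ESnd e => To (cbv e) (Match (Var vz) (Return (Var vz)))
  | ETrue _ => Return (True_ _)
  | EFalse _ => Return (False_ _)
  | EIf e0 e1 e2 =>
      To (cbv e0) (If (Var vz) (weaken _ (cbv e1)) (weaken _ (cbv e2)))
  | ELam e => Return (Thunk (Lam (cbv e)))
  | EApp e e' =>
      To (cbv e) (To (weaken _ (cbv e'))
        (App (Var vz) (Force (Var (vs vz)))))
  end.

Fixpoint cbn_ty (t : sty) : cty :=
  match t with
  | sunit => cF vunit
  | sbool => cF vbool
  | sprod t1 t2 => cprod (cbn_ty t1) (cbn_ty t2)
  | sarr t t' => carr (vU (cbn_ty t)) (cbn_ty t')
  end.

Definition cbn_vty (t : sty) : vty := vU (cbn_ty t).

Fixpoint cbn {G t} (e : exp G t) : cmp (map cbn_vty G) (cbn_ty t) :=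
  match e in exp G t return cmp (map cbn_vty G) (cbn_ty t) with
  | EVar x => Force (Var (var_map cbn_vty x))
  | EUnit _ => Return (Unit _)
  | EPair e1 e2 => LamPair (cbn e1) (cbn e2)
  | EFst e => Proj1 (cbn e)
  | ESnd e => Proj2 (cbn e)
  | ETrue _ => Return (True_ _)
  | EFalse _ => Return (False_ _)
  | EIf e0 e1 e2 =>
      To (cbn e0) (If (Var vz) (weaken _ (cbn e1)) (weaken _ (cbn e2)))
  | ELam e => Lam (cbn e)
  | EApp e e' => App (Thunk (cbn e')) (cbn e)
  end.

(* Main.v *)
(** For each source type [t] there is a relation [rel t] between computations
    [X -> T V(t)] and morphisms [X -> N(t)], indexed by the object [X]: it is
    the order at ground types, componentwise at products, and at function types
    it sends related _computations_ to related results.  A call-by-value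
    environment is accordingly a single computation [m : X -> T V(G)], related
    to a call-by-name environment when each of its projections is.  The
    fundamental lemma says that running [m] and then [V(e)] is related to
    [N(e)].  Discardability lets [m] be projected to the variables in use and
    be extended by an argument.  When [V(e)] evaluates two subterms in sequence,
    copyability runs [m] a second time and centrality moves the second run past
    the first subterm, so that each subterm gets its own run of [m], as in
    call-by-name. *)

From Stdlib Require Import List.
Require Import Defs.
Import ListNotations.

Set Implicit Arguments.
Unset Strict Implicit.
Unset Printing Implicit Defensive.

Local Open Scope cat_scope.

(** Lets unification solve [carrier ?Z = T X]. *)
Canonical free_algebra.

(** * Sequencing in a strong monad, with continuations valued in an arbitrary algebra *)

Section Bind.
Context {C : cartesian_category} {T : strong_monad C}.
Implicit Types A B W X Y : C.

(** This is the shape of the denotation of [To]. The target is any algebra, so that the same laws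
    serve call-by-value computations and call-by-name types. *)
Definition bind (Z : algebra T) {X A} (m : hom X (T A)) (f : hom (X × A) Z) :
  hom X Z := aext Z f ∘ ⟨idm X, m⟩.

Definition ret {A B} (f : hom A B) : hom A (free_algebra T B) := eta B ∘ f.

Lemma hle_trans {X Y} (f g h : hom X Y) : f ⊑ g -> g ⊑ h -> f ⊑ h.
Proof. apply (hle_preorder X Y). Qed.

Lemma comp_mono_l {X Y Y'} (g : hom Y Y') (f f' : hom X Y) :
  f ⊑ f' -> g ∘ f ⊑ g ∘ f'.
Proof. intros H. apply comp_mono; [apply hle_refl | exact H]. Qed.

Lemma comp_mono_r {X Y Y'} (g g' : hom Y Y') (f : hom X Y) :
  g ⊑ g' -> g ∘ f ⊑ g' ∘ f.
Proof. intros H. apply comp_mono; [exact H | apply hle_refl]. Qed.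

(** Naturality in the parameter object absorbs [w] into the continuation; this turns any extension
    applied to a pair into a [bind]. *)
Lemma aext_pair (Z : algebra T) {W X A} (f : hom (W × A) Z) (w : hom X W)
    (m : hom X (T A)) :
  aext Z f ∘ ⟨w, m⟩ = bind m (f ∘ (w ⊗ idm A)).
Proof.
unfold bind. rewrite <- aext_nat, comp_assoc. f_equal. now cart.
Qed.

Lemma bind_comp (Z : algebra T) {W X A} (m : hom X (T A))
    (f : hom (X × A) Z) (w : hom W X) :
  bind m f ∘ w = bind (m ∘ w) (f ∘ (w ⊗ idm A)).
Proof.
rewrite <- aext_pair. unfold bind. rewrite comp_assoc. f_equal. now cart.
Qed.

Lemma bind_mono (Z : algebra T) {X A} (m m' : hom X (T A))
    (f f' : hom (X × A) Z) :
  m ⊑ m' -> f ⊑ f' -> bind m f ⊑ bind m' f'.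
Proof.
intros Hm Hf. apply comp_mono; [now apply aext_mono|].
apply pair_mono; [apply hle_refl | exact Hm].
Qed.

Lemma bind_ret (Z : algebra T) {X A} (v : hom X A) (f : hom (X × A) Z) :
  bind (ret v) f = f ∘ ⟨idm X, v⟩.
Proof.
transitivity (aext Z f ∘ (idm X ⊗ eta A) ∘ ⟨idm X, v⟩).
- unfold bind, ret. rewrite comp_assoc. f_equal. now cart.
- now rewrite aext_eta.
Qed.

(** Associativity of the algebra with both parameter objects equal to [X], precomposed with the
    diagonal of [X]. *)
Lemma bind_bind (Z : algebra T) {X A B} (m : hom X (T A))
    (f : hom (X × A) (free_algebra T B)) (g : hom (X × B) Z) :
  bind (bind m f) g = bind m (bind f (g ∘ (fstm ⊗ idm B))).
Proof.
rewrite <- (aext_pair g fstm f).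
transitivity (aext Z g ∘ (idm X ⊗ mext T f) ∘ assoc ∘ ⟨⟨idm X, idm X⟩, m⟩).
- unfold bind. rewrite !comp_assoc. f_equal. now cart.
- rewrite <- aext_assoc, aext_pair. f_equal. rewrite !comp_assoc. f_equal.
  now cart.
Qed.

(** The unit law is given only for the parameter object [one]; naturality along [bang W] carries it
    to every [W]. *)
Lemma mext_ret_snd W X : mext T (eta X ∘ @sndm C W X) = sndm.
Proof.
transitivity (mext T (eta X ∘ sndm) ∘ (bang W ⊗ idm (T X))).
- rewrite mext_nat. f_equal. rewrite comp_assoc. f_equal. now cart.
- rewrite eta_mext. now cart.
Qed.

Lemma bind_ret_snd X A (m : hom X (T A)) : bind m (ret sndm) = m.
Proof.
unfold bind, ret. cbn [aext free_algebra]. rewrite mext_ret_snd. now cart.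
Qed.

Lemma mmap_comp X A B (f : hom A B) (m : hom X (T A)) :
  mmap T f ∘ m = bind m (ret (f ∘ sndm)).
Proof.
unfold mmap, ext.
transitivity (aext (free_algebra T B) (eta B ∘ f ∘ @sndm C one A)
  ∘ ⟨bang X, m⟩).
- cbn [aext free_algebra]. rewrite !comp_assoc. f_equal. cart.
  now rewrite (bang_eq (bang (T A) ∘ m) (bang X)).
- rewrite aext_pair. unfold ret. f_equal. rewrite !comp_assoc. f_equal.
  f_equal. now cart.
Qed.

Lemma mmap_bind X A B B' (g : hom B B') (m : hom X (T A))
    (f : hom (X × A) (free_algebra T B)) :
  mmap T g ∘ bind m f = bind (Z := free_algebra T B') m (mmap T g ∘ f).
Proof.
rewrite mmap_comp, bind_bind, mmap_comp. unfold ret. do 2 f_equal.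
rewrite !comp_assoc. do 2 f_equal. now cart.
Qed.

Lemma bind_mmap (Z : algebra T) X A B (g : hom A B) (m : hom X (T A))
    (f : hom (X × B) Z) :
  bind (mmap T g ∘ m) f = bind m (f ∘ (idm X ⊗ g)).
Proof.
rewrite mmap_comp, bind_bind, bind_ret. f_equal.
rewrite comp_assoc. f_equal. now cart.
Qed.

(** Makes explicit that [seqL] runs its left argument first. The next lemma shows the opposite order
    for [seqR], with the results still paired in the same order. *)
Lemma seqL_pair X A B (m : hom X (T A)) (m' : hom X (T B)) :
  seqL T A B ∘ ⟨m, m'⟩
  = bind m (bind (m' ∘ fstm) (ret (sndm ⊗ idm B))).
Proof.
transitivity (aext (free_algebra T (A × B))
  (mext T (eta (A × B)) ∘ swap) ∘ ⟨m', m⟩).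
- unfold seqL, mextl. cbn [aext free_algebra]. rewrite comp_assoc. f_equal.
  now cart.
- rewrite aext_pair. f_equal. unfold ret.
  rewrite <- (aext_pair (Z := free_algebra T (A × B)) (eta (A × B)) sndm).
  cbn [aext free_algebra]. rewrite comp_assoc. f_equal. now cart.
Qed.

Lemma seqR_pair X A B (m : hom X (T A)) (m' : hom X (T B)) :
  seqR T A B ∘ ⟨m, m'⟩
  = bind m' (bind (m ∘ fstm) (ret ⟨sndm, sndm ∘ fstm⟩)).
Proof.
unfold seqR, mextl.
change (mext T (mext T (eta (A × B) ∘ swap) ∘ swap)) with
  (aext (free_algebra T (A × B)) (mext T (eta (A × B) ∘ swap) ∘ swap)).
rewrite (aext_pair (Z := free_algebra T (A × B)) _ m m'). f_equal.
transitivity (aext (free_algebra T (A × B)) (eta (A × B) ∘ swap)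
  ∘ ⟨sndm, m ∘ fstm⟩).
- cbn [aext free_algebra]. rewrite comp_assoc. f_equal. now cart.
- rewrite aext_pair. unfold ret. f_equal. rewrite comp_assoc. f_equal.
  now cart.
Qed.

(** * The three lax properties as inequalities between sequenced computations *)

Section LaxLaws.
Variables (Z : algebra T) (X A : C) (m : hom X (T A)).

(** A continuation that ignores its argument factors through [bang A], where discardability replaces
    [m] by a trivial return. *)
Lemma bind_discard (f : hom X Z) :
  lax_discardable m -> bind m (f ∘ fstm) ⊑ f.
Proof.
intros H.
replace (bind m (f ∘ fstm)) with (bind (mmap T (bang A) ∘ m) (f ∘ fstm)).
- apply (hle_trans (g := bind (ret (bang X)) (f ∘ fstm))).
  + apply bind_mono; [exact H | apply hle_refl].
  + rewrite bind_ret. cart. apply hle_refl.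
- rewrite bind_mmap. f_equal. now cart.
Qed.

(** The left side runs [m] once and shares the result, the right side runs it twice, which is what
    [seqL] does on [⟨m, m⟩]. *)
Lemma bind_copy (f : hom ((X × A) × A) Z) :
  lax_copyable m ->
  bind m (f ∘ ⟨idm (X × A), sndm⟩) ⊑ bind m (bind (m ∘ fstm) f).
Proof.
intros H.
replace (bind m (f ∘ ⟨idm (X × A), sndm⟩)) with
  (bind (mmap T ⟨idm A, idm A⟩ ∘ m) (f ∘ assoc_inv)).
- apply (hle_trans (g := bind (seqL T A A ∘ ⟨m, m⟩) (f ∘ assoc_inv))).
  + apply bind_mono; [exact H | apply hle_refl].
  + rewrite seqL_pair, !bind_bind, bind_ret.
    replace (f ∘ assoc_inv ∘ _ ∘ _ ∘ _) with f; [apply hle_refl|].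
    rewrite !comp_assoc. now cart.
- rewrite bind_mmap. f_equal. rewrite comp_assoc. f_equal. now cart.
Qed.

(** Centrality exchanges the two runs; [beta] then hands the results to [f] in their original
    order. *)
Lemma bind_central B (m' : hom X (T B)) (f : hom ((X × A) × B) Z) :
  lax_central m ->
  bind m (bind (m' ∘ fstm) f) ⊑ bind m' (bind (m ∘ fstm) (f ∘ beta)).
Proof.
intros H.
apply (hle_trans (g := bind (seqL T A B ∘ ⟨m, m'⟩) (f ∘ assoc_inv))).
- rewrite seqL_pair, !bind_bind, bind_ret.
  replace (f ∘ assoc_inv ∘ _ ∘ _ ∘ _) with f; [apply hle_refl|].
  rewrite !comp_assoc. now cart.
- apply (hle_trans (g := bind (seqR T A B ∘ ⟨m, m'⟩) (f ∘ assoc_inv))).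
  + apply bind_mono; [|apply hle_refl].
    (* Centrality quantifies over a generic second argument, of which [m'] is an instance by
       precomposition. *)
    replace ⟨m, m'⟩ with ((m ⊗ idm (T B)) ∘ ⟨idm X, m'⟩) by now cart.
    rewrite <- !comp_assoc. apply comp_mono_r, H.
  + rewrite seqR_pair, !bind_bind, bind_ret.
    replace (f ∘ assoc_inv ∘ _ ∘ _ ∘ _) with (f ∘ @beta C X B A);
      [apply hle_refl|].
    rewrite !comp_assoc. f_equal. now cart.
Qed.

End LaxLaws.

End Bind.

Lemma uncurry_pair_comp {C : cartesian_closed_category} {V W X Y : C}
    (g : hom W (X ⇒ Y)) (p : hom W X) (w : hom V W) :
  uncurry (g ∘ w) ∘ ⟨idm V, p ∘ w⟩ = uncurry g ∘ ⟨idm W, p⟩ ∘ w.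
Proof. rewrite uncurry_comp, !comp_assoc. f_equal. now cart. Qed.

Lemma uncurry_curry_pair {C : cartesian_closed_category} {V W X Y : C}
    (f : hom (W × X) Y) (w : hom V W) (p : hom V X) :
  uncurry (curry f ∘ w) ∘ ⟨idm V, p⟩ = f ∘ ⟨w, p⟩.
Proof.
rewrite uncurry_comp, uncurry_curry, comp_assoc. f_equal. now cart.
Qed.

Lemma snd_times {C : cartesian_category} {X X' Y : C} (w : hom X X') :
  sndm ∘ (w ⊗ idm Y) = sndm.
Proof. now cart. Qed.

Lemma assoc_inv_pair_comp {C : cartesian_category} {V W X Y Z : C}
    (f : hom ((W × X) × Y) Z) (p : hom W (X × Y)) (w : hom V W) :
  f ∘ ((w ⊗ idm X) ⊗ idm Y) ∘ assoc_inv ∘ ⟨idm V, p ∘ w⟩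
  = f ∘ assoc_inv ∘ ⟨idm W, p⟩ ∘ w.
Proof. rewrite !comp_assoc. f_equal. now cart. Qed.

(** * Case analysis on the booleans as copairing out of [W × two] *)

Section Conditionals.
Context {C : cartesian_closed_category} (two : coproduct (@one C) (@one C)).
Implicit Types W X Y Z : C.

Lemma dbl_ext W Z (h h' : hom (W × two) Z) :
  h ∘ dbl_inl two W = h' ∘ dbl_inl two W ->
  h ∘ dbl_inr two W = h' ∘ dbl_inr two W -> h = h'.
Proof.
intros Hl Hr.
now rewrite <- (dbl_copair_unique h), <- (dbl_copair_unique h'), Hl, Hr.
Qed.

Lemma times_dbl_inl V W (w : hom V W) :
  (w ⊗ idm two) ∘ dbl_inl two V = dbl_inl two W ∘ w.
Proof.
unfold dbl_inl. cart. now rewrite (bang_eq (bang W ∘ w) (bang V)).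
Qed.

Lemma times_dbl_inr V W (w : hom V W) :
  (w ⊗ idm two) ∘ dbl_inr two V = dbl_inr two W ∘ w.
Proof.
unfold dbl_inr. cart. now rewrite (bang_eq (bang W ∘ w) (bang V)).
Qed.

Lemma comp_dbl_copair W Y Z (h : hom Y Z) (f g : hom W Y) :
  h ∘ dbl_copair two f g = dbl_copair two (h ∘ f) (h ∘ g).
Proof.
apply dbl_ext; now rewrite comp_assoc, ?dbl_copair_inl, ?dbl_copair_inr.
Qed.

Lemma dbl_copair_times V W Z (f g : hom W Z) (w : hom V W) :
  dbl_copair two f g ∘ (w ⊗ idm two) = dbl_copair two (f ∘ w) (g ∘ w).
Proof.
apply dbl_ext; rewrite comp_assoc, ?times_dbl_inl, ?times_dbl_inr,
  <- comp_assoc; now rewrite ?dbl_copair_inl, ?dbl_copair_inr.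
Qed.

Lemma dbl_copair_pair_comp V W Z (f g : hom W Z) (b : hom W two)
    (w : hom V W) :
  dbl_copair two (f ∘ w) (g ∘ w) ∘ idm _ ∘ ⟨idm V, b ∘ w⟩
  = dbl_copair two f g ∘ idm _ ∘ ⟨idm W, b⟩ ∘ w.
Proof.
rewrite <- dbl_copair_times, !comp_assoc. f_equal. now cart.
Qed.

End Conditionals.

(** * Semantic application and conditional, and how they commute with the algebra structure *)

Section ModelOperations.
Context {C : cartesian_closed_category} {T : strong_monad C}.
Context (two : coproduct (@one C) (@one C)).
Implicit Types P Q W X Y : C.

Definition eval_last {X P Y} : hom ((X × (P ⇒ Y)) × P) Y :=
  ev ∘ ⟨sndm ∘ fstm, sndm⟩.

(** The function is evaluated before its argument, as in the call-by-value translation. *)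
Definition cbv_app {X P Q} (m : hom X (T (P ⇒ T Q))) (m' : hom X (T P)) :
  hom X (T Q) :=
  bind (Z := free_algebra T Q) m
    (bind (Z := free_algebra T Q) (m' ∘ fstm) eval_last).

Definition cond {Z : algebra T} {X} (b : hom X (T two)) (f g : hom X Z) :
  hom X Z := bind b (dbl_copair two f g).

Lemma cbv_app_mono X P Q (m1 m2 : hom X (T (P ⇒ T Q))) (m' : hom X (T P)) :
  m1 ⊑ m2 -> cbv_app m1 m' ⊑ cbv_app m2 m'.
Proof. intros H. unfold cbv_app. apply bind_mono; [exact H | apply hle_refl]. Qed.

Lemma cond_comp (Z : algebra T) W X (b : hom X (T two)) (f g : hom X Z)
    (w : hom W X) :
  cond b f g ∘ w = cond (b ∘ w) (f ∘ w) (g ∘ w).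
Proof. unfold cond. now rewrite bind_comp, dbl_copair_times. Qed.

Lemma mmap_cond X A B (h : hom A B) (b : hom X (T two)) (f g : hom X (T A)) :
  mmap T h ∘ cond (Z := free_algebra T A) b f g
  = cond (Z := free_algebra T B) b (mmap T h ∘ f) (mmap T h ∘ g).
Proof. unfold cond. rewrite mmap_bind. f_equal. apply comp_dbl_copair. Qed.

Lemma bind_dbl_copair (Z : algebra T) X A (f g : hom X (T A))
    (k : hom (X × A) Z) :
  bind (dbl_copair two f g) (k ∘ (fstm ⊗ idm A))
  = dbl_copair two (bind f k) (bind g k).
Proof.
apply dbl_ext; rewrite bind_comp, ?dbl_copair_inl, ?dbl_copair_inr;
  f_equal; rewrite comp_assoc; unfold dbl_inl, dbl_inr; now cart.
Qed.

Lemma bind_cond (Z : algebra T) X A (b : hom X (T two)) (f g : hom X (T A))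
    (k : hom (X × A) Z) :
  bind (cond (Z := free_algebra T A) b f g) k = cond b (bind f k) (bind g k).
Proof. unfold cond. now rewrite bind_bind, bind_dbl_copair. Qed.

Lemma fst_cond (Z1 Z2 : algebra T) X (b : hom X (T two))
    (f g : hom X (prod_algebra Z1 Z2)) :
  fstm ∘ cond b f g = cond (Z := Z1) b (fstm ∘ f) (fstm ∘ g).
Proof.
unfold cond, bind. rewrite <- comp_dbl_copair. apply fst_pair_comp.
Qed.

Lemma snd_cond (Z1 Z2 : algebra T) X (b : hom X (T two))
    (f g : hom X (prod_algebra Z1 Z2)) :
  sndm ∘ cond b f g = cond (Z := Z2) b (sndm ∘ f) (sndm ∘ g).
Proof.
unfold cond, bind. rewrite <- comp_dbl_copair. apply snd_pair_comp.
Qed.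

(** The power algebra extends maps pointwise, so applying a conditional to [p] is a conditional
    between applications to [p]. *)
Lemma uncurry_cond P (Z : algebra T) X (b : hom X (T two))
    (f g : hom X (P ⇒ Z)) (p : hom X P) :
  uncurry (cond (Z := power_algebra P Z) b f g) ∘ ⟨idm X, p⟩
  = cond b (uncurry f ∘ ⟨idm X, p⟩) (uncurry g ∘ ⟨idm X, p⟩).
Proof.
unfold cond, bind. cbn [aext carrier power_algebra].
rewrite uncurry_comp.
unfold power_aext. rewrite uncurry_curry.
transitivity (aext Z (uncurry (dbl_copair two f g) ∘ @beta C X P two)
  ∘ ⟨⟨idm X, p⟩, b⟩).
- rewrite !comp_assoc. f_equal. now cart.
- rewrite aext_pair. unfold bind. f_equal. f_equal.
  transitivity (uncurry (dbl_copair two f g) ∘ ⟨idm _, p ∘ fstm⟩).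
  + rewrite comp_assoc. f_equal. now cart.
  + apply dbl_ext; rewrite ?dbl_copair_inl, ?dbl_copair_inr.
    * rewrite <- (dbl_copair_inl two f g) at 2.
      rewrite uncurry_comp, !comp_assoc. f_equal. unfold dbl_inl. now cart.
    * rewrite <- (dbl_copair_inr two f g) at 2.
      rewrite uncurry_comp, !comp_assoc. f_equal. unfold dbl_inr. now cart.
Qed.

Lemma cbv_app_cond X P Q (b : hom X (T two)) (f g : hom X (T (P ⇒ T Q)))
    (m' : hom X (T P)) :
  cbv_app (cond (Z := free_algebra T (P ⇒ T Q)) b f g) m'
  = cond (Z := free_algebra T Q) b (cbv_app f m') (cbv_app g m').
Proof. apply bind_cond. Qed.

(** A beta law: applying a closure built from the environment computation [m] runs its body in the
    environment extended by [p] through [seqL]. *)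
Lemma cbv_app_curry X A P Q (m : hom X (T A)) (p : hom X (T P))
    (b : hom (A × P) (T Q)) :
  cbv_app (bind m (ret (curry b) ∘ sndm)) p
  = bind (Z := free_algebra T Q) (seqL T A P ∘ ⟨m, p⟩) (b ∘ sndm).
Proof.
unfold cbv_app, eval_last. rewrite seqL_pair, !bind_bind. f_equal.
replace (ret (curry b) ∘ @sndm C X A)
  with (ret (T := T) (curry b ∘ @sndm C X A)) by (unfold ret; now rewrite comp_assoc).
rewrite !bind_ret, !bind_comp. f_equal.
- now cart.
- transitivity (uncurry (curry b) ∘ (@sndm C X A ⊗ idm P)).
  + unfold uncurry. rewrite !comp_assoc. f_equal. now cart.
  + rewrite uncurry_curry, !comp_assoc. f_equal. now cart.
Qed.

(** * Distributing an environment computation over subterms *)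

Section Lax.
Hypothesis discardable : forall X Y (f : hom X (T Y)), lax_discardable f.
Hypothesis copyable : forall X Y (f : hom X (T Y)), lax_copyable f.
Hypothesis central : forall X Y (f : hom X (T Y)), lax_central f.

Lemma mmap_fst_seqL X A B (m : hom X (T A)) (m' : hom X (T B)) :
  mmap T fstm ∘ (seqL T A B ∘ ⟨m, m'⟩) ⊑ m.
Proof.
rewrite seqL_pair, !mmap_bind.
apply (hle_trans (g := bind m (ret sndm)));
  [|rewrite bind_ret_snd; apply hle_refl].
apply bind_mono; [apply hle_refl|].
eapply hle_trans; [|apply (bind_discard (m := m' ∘ fstm)), discardable].
apply bind_mono; [apply hle_refl|].
rewrite mmap_comp, bind_ret. unfold ret. cart. apply hle_refl.
Qed.

Lemma mmap_snd_seqL X A B (m : hom X (T A)) (m' : hom X (T B)) :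
  mmap T sndm ∘ (seqL T A B ∘ ⟨m, m'⟩) ⊑ m'.
Proof.
rewrite seqL_pair, !mmap_bind.
eapply hle_trans;
  [|apply (bind_discard (Z := free_algebra T B) m' (discardable m))].
apply bind_mono; [apply hle_refl|].
apply (hle_trans (g := bind (m' ∘ fstm) (ret sndm)));
  [|rewrite bind_ret_snd; apply hle_refl].
apply bind_mono; [apply hle_refl|].
rewrite mmap_comp, bind_ret. unfold ret. cart. apply hle_refl.
Qed.

(** The outer computation is duplicated, and its second copy is then moved
    past the inner one. *)
Lemma bind_nested (Z : algebra T) X A B (m : hom X (T A)) (f : hom A (T B))
    (g : hom (A × B) Z) :
  bind m (bind f g ∘ sndm)
  ⊑ bind (bind (Z := free_algebra T B) m (f ∘ sndm))
      (bind (m ∘ fstm) (g ∘ ⟨sndm, sndm ∘ fstm⟩)).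
Proof.
(* Of the two copies of the result of [m], [f] will read the first and [h] passes only the second to
   [g]. *)
set (h := g ∘ ⟨sndm ∘ fstm, sndm⟩ : hom (((X × A) × A) × B) Z).
replace (bind m (bind f g ∘ sndm)) with
  (bind m (bind (f ∘ sndm ∘ fstm) h ∘ ⟨idm (X × A), sndm⟩)).
- eapply hle_trans; [apply bind_copy, copyable|].
  eapply hle_trans.
  + apply bind_mono; [apply hle_refl | apply bind_central, central].
  + rewrite bind_bind.
    replace (bind (m ∘ fstm) (g ∘ _) ∘ (fstm ⊗ idm B)) with
      (bind (m ∘ fstm ∘ fstm) (h ∘ beta)); [apply hle_refl|].
    rewrite bind_comp. unfold h. f_equal; rewrite !comp_assoc; f_equal;
    now cart.
- rewrite !bind_comp. f_equal. unfold h. f_equal; rewrite !comp_assoc; f_equal;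
    now cart.
Qed.

Lemma bind_cbv_app X A P Q (m : hom X (T A)) (f : hom A (T (P ⇒ T Q)))
    (g : hom A (T P)) :
  bind m (cbv_app f g ∘ sndm)
  ⊑ cbv_app (bind m (f ∘ sndm)) (bind m (g ∘ sndm)).
Proof.
unfold cbv_app at 1. eapply hle_trans; [apply bind_nested|].
unfold cbv_app. apply bind_mono; [apply hle_refl|].
(* The second run of [m] now feeds only [g], so reassociation groups the two into the argument. *)
rewrite !bind_comp, bind_bind.
match goal with |- ?a ⊑ ?b => replace a with b; [apply hle_refl|] end.
unfold eval_last. f_equal. f_equal; rewrite !comp_assoc; f_equal; now cart.
Qed.

(** The guard takes the first run of [m]. The second run precedes the case analysis and is pushed
    into both branches, by comparing the two sides on each coprojection. *)
Lemma bind_cond_nested (Z : algebra T) X A (m : hom X (T A))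
    (b : hom A (T two)) (f g : hom A Z) :
  bind m (cond b f g ∘ sndm)
  ⊑ cond (bind m (b ∘ sndm)) (bind m (f ∘ sndm)) (bind m (g ∘ sndm)).
Proof.
unfold cond at 1. eapply hle_trans; [apply bind_nested|].
unfold cond. apply bind_mono; [apply hle_refl|].
match goal with |- ?a ⊑ ?b => replace a with b; [apply hle_refl|] end.
apply dbl_ext; rewrite ?dbl_copair_inl, ?dbl_copair_inr, bind_comp.
- f_equal; [unfold dbl_inl; now cart|].
  transitivity (dbl_copair two f g ∘ (sndm ⊗ idm two) ∘ dbl_inl two (X × A)).
  + now rewrite dbl_copair_times, dbl_copair_inl.
  + unfold dbl_inl. rewrite !comp_assoc. f_equal. cart.
    now rewrite (bang_eq (bang X ∘ fstm) (bang (X × A))).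
- f_equal; [unfold dbl_inr; now cart|].
  transitivity (dbl_copair two f g ∘ (sndm ⊗ idm two) ∘ dbl_inr two (X × A)).
  + now rewrite dbl_copair_times, dbl_copair_inr.
  + unfold dbl_inr. rewrite !comp_assoc. f_equal. cart.
    now rewrite (bang_eq (bang X ∘ fstm) (bang (X × A))).
Qed.

End Lax.

End ModelOperations.

(* Denotations of renamed and weakened terms *)
Scheme val_mut_ind := Induction for val Sort Prop
  with cmp_mut_ind := Induction for cmp Sort Prop.
Combined Scheme val_cmp_ind from val_mut_ind, cmp_mut_ind.

Section Renaming.
Context (M : cbpv_model).

(** The morphism [w] interprets [r] contravariantly, from the target context to the source
    context. *)
Definition ren_den {G D} (r : renaming G D)
    (w : hom (den_ctx M D) (den_ctx M G)) : Prop :=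
  forall A (x : var G A), den_var M (r A x) = den_var M x ∘ w.

Lemma ren_den_lift G D A (r : renaming G D)
    (w : hom (den_ctx M D) (den_ctx M G)) :
  ren_den r w -> ren_den (lift (A0 := A) r) (w ⊗ idm (den_vty M A)).
Proof.
intros H A' x. revert r w H.
(* The return type is computed from the context index, which inverts the nonempty context of [x]
   without axioms. *)
refine (match x in var G' A' return
  match G' return var G' A' -> Prop with
  | [] => fun _ => True
  | A0 :: G0 => fun x => forall (r : renaming G0 D)
      (w : hom (den_ctx M D) (den_ctx M G0)), ren_den r w ->
      den_var M (lift (A0 := A0) r x)
      = den_var M x ∘ (w ⊗ idm (den_vty M A0))
  end x with
  | vz => _
  | vs y => _
  end); intros r w H; cbn.
- now cart.
- rewrite H. now cart.
Qed.

Lemma den_ren :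
  (forall G A (V : val G A) D (r : renaming G D)
    (w : hom (den_ctx M D) (den_ctx M G)), ren_den r w ->
    den_val M (ren_val V r) = den_val M V ∘ w) /\
  (forall G B (N : cmp G B) D (r : renaming G D)
    (w : hom (den_ctx M D) (den_ctx M G)), ren_den r w ->
    den_cmp M (ren_cmp N r) = den_cmp M N ∘ w).
Proof.
apply val_cmp_ind; intros.
- cbn. auto.
- apply bang_eq.
- cbn. erewrite H, H0 by eassumption. now rewrite pair_comp.
- cbn. rewrite comp_assoc. f_equal. apply bang_eq.
- cbn. rewrite comp_assoc. f_equal. apply bang_eq.
- now apply H.
- cbn. erewrite H, H0 by eassumption. now rewrite pair_comp.
- cbn. erewrite H by eassumption. now rewrite comp_assoc.
- cbn. erewrite H by eassumption. now rewrite comp_assoc.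
- cbn. erewrite H by (apply ren_den_lift; eassumption). symmetry.
  apply curry_comp.
- change (uncurry (den_cmp M (ren_cmp c r)) ∘ ⟨idm _, den_val M (ren_val v r)⟩
    = uncurry (den_cmp M c) ∘ ⟨idm _, den_val M v⟩ ∘ w).
  erewrite H, H0 by eassumption. apply uncurry_pair_comp.
- change (ret (T := model_monad M) (den_val M (ren_val v r))
    = ret (T := model_monad M) (den_val M v) ∘ w).
  erewrite H by eassumption. unfold ret. now rewrite comp_assoc.
- cbn. erewrite H, H0 by first [eassumption | apply ren_den_lift; eassumption].
  symmetry. apply bind_comp.
- change (den_cmp M (ren_cmp c (lift (lift r))) ∘ assoc_inv
    ∘ ⟨idm _, den_val M (ren_val v r)⟩
    = den_cmp M c ∘ assoc_inv ∘ ⟨idm _, den_val M v⟩ ∘ w).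
  erewrite H, H0 by first [eassumption | do 2 apply ren_den_lift; eassumption].
  apply assoc_inv_pair_comp.
- change (dbl_copair (model_two M) (den_cmp M (ren_cmp c r))
      (den_cmp M (ren_cmp c0 r)) ∘ idm _ ∘ ⟨idm _, den_val M (ren_val v r)⟩
    = dbl_copair (model_two M) (den_cmp M c) (den_cmp M c0) ∘ idm _
      ∘ ⟨idm _, den_val M v⟩ ∘ w).
  erewrite H, H0, H1 by eassumption. apply dbl_copair_pair_comp.
- now apply H.
Qed.

Lemma den_weaken G A B (N : cmp G B) :
  den_cmp M (weaken A N) = den_cmp M N ∘ fstm.
Proof. apply den_ren. intros A' x. reflexivity. Qed.

End Renaming.

(** * Denotations of the translations and the logical relation *)

Section LogicalRelation.
Context (M : cbpv_model).
Let T := model_monad M.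
Let two := model_two M.
Implicit Types X Y W : M.

Lemma den_cbv_pair G t1 t2 (e1 : exp G t1) (e2 : exp G t2) :
  den_cmp M (cbv (EPair e1 e2))
  = seqL T _ _ ∘ ⟨den_cmp M (cbv e1), den_cmp M (cbv e2)⟩.
Proof.
etransitivity; [|symmetry; apply seqL_pair].
cbn. rewrite den_weaken. unfold bind, ret. cbn. now cart.
Qed.

Lemma den_cbv_fst G t1 t2 (e : exp G (sprod t1 t2)) :
  den_cmp M (cbv (EFst e)) = mmap T fstm ∘ den_cmp M (cbv e).
Proof.
etransitivity; [|symmetry; apply mmap_comp].
cbn. unfold bind, ret. cbn. now cart.
Qed.

Lemma den_cbv_snd G t1 t2 (e : exp G (sprod t1 t2)) :
  den_cmp M (cbv (ESnd e)) = mmap T sndm ∘ den_cmp M (cbv e).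
Proof.
etransitivity; [|symmetry; apply mmap_comp].
cbn. unfold bind, ret. cbn. now cart.
Qed.

Lemma den_cbv_app G t t' (e : exp G (sarr t t')) (e' : exp G t) :
  den_cmp M (cbv (EApp e e'))
  = cbv_app (den_cmp M (cbv e)) (den_cmp M (cbv e')).
Proof.
unfold cbv_app, bind, eval_last. cbn. rewrite den_weaken.
unfold uncurry. now cart.
Qed.

(** Stated for any computation type because both translations of the conditional have this form. *)
Lemma den_if_vz (G : list vty) B (N1 N2 : cmp G B) (b : cmp G (cF vbool)) :
  den_cmp M (To b (If (Var vz) (weaken _ N1) (weaken _ N2)))
  = cond (two := two) (den_cmp M b) (den_cmp M N1) (den_cmp M N2).
Proof.
unfold cond, bind. cbn. rewrite !den_weaken. do 2 f_equal.
unfold dist. rewrite comp_idr. rewrite <- dbl_copair_times, comp_assoc.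
rewrite <- comp_idr. f_equal. now cart.
Qed.

(** The function case quantifies over a change of index object [w], in Kripke style, so that related
    pairs are stable under precomposition. *)
Fixpoint rel (t : sty) : forall X,
    hom X (T (den_vty M (cbv_ty t))) -> hom X (den_cty M (cbn_ty t)) -> Prop :=
  match t return forall X, hom X (T (den_vty M (cbv_ty t))) ->
      hom X (den_cty M (cbn_ty t)) -> Prop with
  | sunit => fun X m n => m ⊑ n
  | sbool => fun X m n => m ⊑ n
  | sprod t1 t2 => fun X m n =>
      rel (t := t1) (mmap T fstm ∘ m) (fstm ∘ n) /\
      rel (t := t2) (mmap T sndm ∘ m) (sndm ∘ n)
  | sarr t t' => fun X m n => forall W (w : hom W X) m' n',
      rel (t := t) m' n' ->
      rel (t := t') (cbv_app (m ∘ w) m') (uncurry (n ∘ w) ∘ ⟨idm W, n'⟩)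
  end.

Fixpoint rel_ctx (G : list sty) : forall X,
    hom X (T (den_ctx M (map cbv_ty G))) ->
    hom X (den_ctx M (map cbn_vty G)) -> Prop :=
  match G return forall X, hom X (T (den_ctx M (map cbv_ty G))) ->
      hom X (den_ctx M (map cbn_vty G)) -> Prop with
  | [] => fun X m n => True
  | t :: G => fun X m n =>
      rel_ctx (G := G) (mmap T fstm ∘ m) (fstm ∘ n) /\
      rel (t := t) (mmap T sndm ∘ m) (sndm ∘ n)
  end.

(** Every operation applied to the call-by-value side is monotone. This closure is what lets the lax
    inequalities be used inside the relation. *)
Lemma rel_le t X (m m' : hom X (T (den_vty M (cbv_ty t))))
    (n : hom X (den_cty M (cbn_ty t))) :
  m ⊑ m' -> rel m' n -> rel m n.
Proof.
revert X m m' n. induction t as [| | t1 IH1 t2 IH2 | t IH t' IH']; cbn;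
  intros X m m' n Hm H.
- exact (hle_trans Hm H).
- exact (hle_trans Hm H).
- destruct H as [H1 H2]. split.
  + exact (IH1 _ _ _ _ (comp_mono_l _ Hm) H1).
  + exact (IH2 _ _ _ _ (comp_mono_l _ Hm) H2).
- intros W w p q Hpq. refine (IH' _ _ _ _ _ (H W w p q Hpq)).
  apply cbv_app_mono, comp_mono_r, Hm.
Qed.

Lemma rel_le_eq t X (m m' : hom X (T (den_vty M (cbv_ty t))))
    (n n' : hom X (den_cty M (cbn_ty t))) :
  m ⊑ m' -> n' = n -> rel m' n' -> rel m n.
Proof. intros Hm <-. now apply rel_le. Qed.

Lemma rel_comp t X W (w : hom W X) (m : hom X (T (den_vty M (cbv_ty t))))
    (n : hom X (den_cty M (cbn_ty t))) :
  rel m n -> rel (m ∘ w) (n ∘ w).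
Proof.
revert X W w m n. induction t as [| | t1 IH1 t2 IH2 | t IH t' IH']; cbn;
  intros X W w m n H.
- apply comp_mono_r, H.
- apply comp_mono_r, H.
- rewrite <- !comp_assoc. destruct H as [H1 H2]. auto.
- intros V v p q Hpq. rewrite !comp_assoc. auto.
Qed.

Lemma rel_ctx_le G X (m m' : hom X (T (den_ctx M (map cbv_ty G))))
    (n : hom X (den_ctx M (map cbn_vty G))) :
  m ⊑ m' -> rel_ctx m' n -> rel_ctx m n.
Proof.
revert X m m' n. induction G as [|t G IH]; cbn; intros X m m' n Hm H.
- exact I.
- destruct H as [H1 H2]. split.
  + exact (IH _ _ _ _ (comp_mono_l _ Hm) H1).
  + exact (rel_le (comp_mono_l _ Hm) H2).
Qed.

Lemma rel_ctx_comp G X W (w : hom W X)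
    (m : hom X (T (den_ctx M (map cbv_ty G))))
    (n : hom X (den_ctx M (map cbn_vty G))) :
  rel_ctx m n -> rel_ctx (m ∘ w) (n ∘ w).
Proof.
revert X W w m n. induction G as [|t G IH]; cbn; intros X W w m n H.
- exact I.
- rewrite <- !comp_assoc. destruct H as [H1 H2].
  split; [auto | now apply rel_comp].
Qed.

(** Conditionals commute with projections and application on both sides, which reduces every type to
    the ground types, where monotonicity suffices. *)
Lemma rel_cond t X (b b' : hom X (T two))
    (m1 m2 : hom X (T (den_vty M (cbv_ty t))))
    (n1 n2 : hom X (den_cty M (cbn_ty t))) :
  b ⊑ b' -> rel m1 n1 -> rel m2 n2 ->
  rel (cond (Z := free_algebra T _) b m1 m2) (cond b' n1 n2).
Proof.
revert X b b' m1 m2 n1 n2.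
induction t as [| | t1 IH1 t2 IH2 | t IH t' IH'];
  intros X b b' m1 m2 n1 n2 Hb H1 H2.
- apply bind_mono; [exact Hb|]. now apply dbl_copair_mono.
- apply bind_mono; [exact Hb|]. now apply dbl_copair_mono.
- destruct H1 as [H11 H12], H2 as [H21 H22]. split.
  + cbn [cbv_ty cbn_ty den_vty den_cty]. rewrite mmap_cond, fst_cond. auto.
  + cbn [cbv_ty cbn_ty den_vty den_cty]. rewrite mmap_cond, snd_cond. auto.
- intros W w p q Hpq. rewrite !cond_comp.
  cbn [cbv_ty cbn_ty den_vty den_cty carrier power_algebra free_algebra].
  rewrite cbv_app_cond, uncurry_cond.
  apply IH'; [now apply comp_mono_r | now apply H1 | now apply H2].
Qed.

Lemma rel_var G t (x : var G t) X (m : hom X (T (den_ctx M (map cbv_ty G))))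
    (n : hom X (den_ctx M (map cbn_vty G))) :
  rel_ctx m n ->
  rel (mmap T (den_var M (var_map cbv_ty x)) ∘ m)
    (den_var M (var_map cbn_vty x) ∘ n).
Proof.
revert X m n. induction x as [G t | G t t' x IH]; intros X m n [H1 H2]; cbn.
- exact H2.
- replace (mmap T _ ∘ m) with
    (mmap T (den_var M (var_map cbv_ty x)) ∘ (mmap T fstm ∘ m)).
  + rewrite comp_assoc. now apply IH.
  + rewrite mmap_comp, bind_mmap, mmap_comp. f_equal. unfold ret.
    rewrite !comp_assoc. do 2 f_equal. now cart.
Qed.

(** * The fundamental lemma, under the three lax properties *)

Hypothesis discardable : forall X Y (f : hom X (T Y)), lax_discardable f.
Hypothesis copyable : forall X Y (f : hom X (T Y)), lax_copyable f.
Hypothesis central : forall X Y (f : hom X (T Y)), lax_central f.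

(** Each projection of the sequenced environment discards the other component, hence lies below a
    related computation. *)
Lemma rel_ctx_cons G t X (m : hom X (T (den_ctx M (map cbv_ty G))))
    (m' : hom X (T (den_vty M (cbv_ty t))))
    (n : hom X (den_ctx M (map cbn_vty G)))
    (n' : hom X (den_cty M (cbn_ty t))) :
  rel_ctx m n -> rel m' n' ->
  rel_ctx (G := t :: G) (seqL T _ _ ∘ ⟨m, m'⟩) ⟨n, n'⟩.
Proof.
intros H H'. split.
- rewrite fst_pair. refine (rel_ctx_le _ H). now apply mmap_fst_seqL.
- rewrite snd_pair. refine (rel_le _ H'). now apply mmap_snd_seqL.
Qed.

(** Serves the constants [()], [true] and [false], whose denotations ignore the environment. *)
Lemma bind_const_le X A B (m : hom X (T A)) (v : hom A (T B))
    (v' : hom X (T B)) :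
  v ∘ sndm = v' ∘ @fstm M X A -> bind m (v ∘ sndm) ⊑ v'.
Proof. intros ->. apply bind_discard, discardable. Qed.

Theorem fundamental G t (e : exp G t) X
    (m : hom X (T (den_ctx M (map cbv_ty G))))
    (n : hom X (den_ctx M (map cbn_vty G))) :
  rel_ctx m n ->
  rel (bind (Z := free_algebra T _) m (den_cmp M (cbv e) ∘ sndm))
    (den_cmp M (cbn e) ∘ n).
Proof.
revert X m n.
induction e as [G t x | G | G t1 t2 e1 IH1 e2 IH2 | G t1 t2 e IH
  | G t1 t2 e IH | G | G | G t e0 IH0 e1 IH1 e2 IH2 | G t t' e IH
  | G t t' e IH e' IH']; intros X m n H.
- pose proof (rel_var x H) as Hx. rewrite mmap_comp in Hx.
  refine (rel_le _ Hx). apply bind_mono; [apply hle_refl|].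
  cbn. unfold ret. rewrite comp_assoc. apply hle_refl.
- apply bind_const_le. cbn. rewrite !comp_assoc. f_equal. apply bang_eq.
(* Projecting the pair discards the component that call-by-name would never run. *)
- rewrite den_cbv_pair. split.
  + refine (rel_le_eq _ _ (IH1 _ _ _ H)); [|symmetry; apply fst_pair_comp].
    rewrite mmap_bind. apply bind_mono; [apply hle_refl|].
    rewrite <- comp_assoc. apply comp_mono_r. now apply mmap_fst_seqL.
  + refine (rel_le_eq _ _ (IH2 _ _ _ H)); [|symmetry; apply snd_pair_comp].
    rewrite mmap_bind. apply bind_mono; [apply hle_refl|].
    rewrite <- comp_assoc. apply comp_mono_r. now apply mmap_snd_seqL.
- destruct (IH _ _ _ H) as [H1 _]. refine (rel_le_eq _ _ H1).
  + rewrite den_cbv_fst, comp_assoc, mmap_bind. apply hle_refl.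
  + symmetry. apply comp_assoc.
- destruct (IH _ _ _ H) as [_ H2]. refine (rel_le_eq _ _ H2).
  + rewrite den_cbv_snd, comp_assoc, mmap_bind. apply hle_refl.
  + symmetry. apply comp_assoc.
- apply bind_const_le. cbn. rewrite !comp_assoc. do 2 f_equal. apply bang_eq.
- apply bind_const_le. cbn. rewrite !comp_assoc. do 2 f_equal. apply bang_eq.
- pose proof (rel_cond (IH0 _ _ _ H) (IH1 _ _ _ H) (IH2 _ _ _ H)) as Hc.
  refine (rel_le_eq _ _ Hc).
  + cbn [cbv]. rewrite den_if_vz. now apply bind_cond_nested.
  + cbn [cbn]. rewrite den_if_vz. symmetry. apply cond_comp.
- intros W w p q Hpq.
  refine (rel_le_eq _ _ (IH _ _ _ (rel_ctx_cons (rel_ctx_comp w H) Hpq))).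
  + rewrite bind_comp, comp_assoc, snd_times.
    (* The two sides are equal by the beta law, whose left side matches only up to conversion, so
       the equation is transported rather than rewritten. *)
    refine (eq_ind_r (fun h => h ⊑ _) (hle_refl _) _).
    apply cbv_app_curry.
  + rewrite comp_assoc. symmetry. apply uncurry_curry_pair.
(* No change of index object is needed here; the argument is related as a whole computation run from
   its own copy of [m]. *)
- specialize (IH _ _ _ H X (idm X) _ _ (IH' _ _ _ H)).
  refine (rel_le_eq _ _ IH).
  + rewrite den_cbv_app, comp_idr. now apply bind_cbv_app.
  + rewrite comp_idr. apply uncurry_pair_comp.
Qed.

End LogicalRelation.

Theorem corollary4p8 (M : cbpv_model) (R : program -> program -> Prop)
  (R_rel : program_relation R)
  (M_adequate : adequate M R)
  (all_discardable : forall (X Y : M) (f : hom X (model_monad M Y)),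
    lax_discardable f)
  (all_copyable : forall (X Y : M) (f : hom X (model_monad M Y)),
    lax_copyable f)
  (all_central : forall (X Y : M) (f : hom X (model_monad M Y)),
    lax_central f)
  (e : exp nil sbool) :
  R (cbv e) (cbn e).
Proof.
apply (M_adequate _ _ (cbv e) (cbn e)) with (E := KHole).
(* The empty environment is the pure computation returning the unique point of [one]; at [bool] the
   relation is the order itself. *)
pose proof (fundamental all_discardable all_copyable all_central e
  (m := ret (idm one)) (n := idm one) I) as H.
cbn in H. rewrite comp_idr in H. refine (hle_trans _ H).
refine (eq_ind_r (fun h => _ ⊑ h) (hle_refl _) _).
etransitivity; [apply bind_ret|]. cbn. now cart.
Qed.
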